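(* Let $b \ge 2$ be an even integer. Then the sequence $\{SG_{1,b}(n)\}_{n\ge 1}$ is $b$-automatic.
   Context: For a finite set $X$ of non-negative integers, $\mathrm{mex}(X)$ denotes the smallest non-negative integer not in $X$. For an integer $b\ge 2$, $G_{1,b}(n)$ is the two-player impartial game starting from the total $n\ge 1$ in which players alternately replace the current total $m$ either by $m-1$ or by $\lceil m/b\rceil$; the total $1$ is terminal (the player who says $1$ wins). Its Sprague--Grundy function $SG_{1,b}$ on the positive integers is given by $SG_{1,b}(1)=0$ and, for $n\ge 2$, $SG_{1,b}(n)=\mathrm{mex}\{SG_{1,b}(n-1),\,SG_{1,b}(\lceil n/b\rceil)\}$. A sequence $\{a_n\}$ is $k$-automatic if there is a deterministic finite automaton with output (DFAO) that, when given the base-$k$ digits of $n$, returns the value $a_n$. *)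

(* Defs.v *)
From mathcomp Require Import all_boot.
From mathcomp Require Import zify.

Set Implicit Arguments.
Unset Strict Implicit.
Unset Printing Implicit Defensive.

(* A finite set of naturals is given by a list of its elements. *)
Fact mex_subproof (s : seq nat) : exists i, i \notin s.
Proof.
have le_sum x : x \in s -> x <= sumn s.
  elim: s => //= y s IH; rewrite inE => /orP[/eqP->|/IH]; first exact: leq_addr.
  by move/leq_trans; apply; apply: leq_addl.
by exists (sumn s).+1; apply/negP => /le_sum; rewrite ltnn.
Qed.

Definition mex (s : seq nat) : nat := ex_minn (mex_subproof s).

Definition ceil_div (n b : nat) : nat := (n + b.-1) %/ b.

Lemma leq_ceil_div n b q : 0 < b -> (ceil_div n b <= q) = (n <= q * b).
Proof.
move=> b_gt0; rewrite /ceil_div -ltnS ltn_divLR // mulSn.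
by apply/idP/idP; lia.
Qed.

Lemma ceil_div_gt0 n b : 0 < b -> 0 < n -> 0 < ceil_div n b.
Proof. by move=> b_gt0 n_gt0; rewrite ltnNge leq_ceil_div // mul0n -ltnNge. Qed.

Lemma ceil_div_lt n b : 1 < b -> 1 < n -> ceil_div n b < n.
Proof.
by case: n => // n b_gt1 n_gt1; rewrite ltnS leq_ceil_div ?(ltnW b_gt1) //; nia.
Qed.

(* The Sprague-Grundy recursion descends from n to n - 1 and ceil (n / b), both
   smaller than n when n, b >= 2, so n units of fuel suffice; SG_succ is the
   resulting recurrence.  The value at 0 is junk. *)
Fixpoint SG_fuel (b fuel n : nat) : nat :=
  if fuel is fuel'.+1 then
    if n <= 1 then 0
    else mex [:: SG_fuel b fuel' n.-1; SG_fuel b fuel' (ceil_div n b)]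
  else 0.

Definition SG (b n : nat) : nat := SG_fuel b n n.

Lemma SG_fuelE b f n : 1 < b -> n <= f -> SG_fuel b f n = SG b n.
Proof.
move=> b_gt1; rewrite /SG.
have key g h m : m <= g -> m <= h -> SG_fuel b g m = SG_fuel b h m.
  elim: g h m => [|g IH] [|h] m //=.
  - by rewrite leqn0 => /eqP->.
  - by move=> _; rewrite leqn0 => /eqP->.
  move=> mg mh; case: ifPn => //; rewrite -ltnNge => m_gt1.
  have lt_c := ceil_div_lt b_gt1 m_gt1.
  by congr (mex [:: _; _]); apply: IH; lia.
by move=> le_nf; apply: key.
Qed.

Lemma SG_1 b : SG b 1 = 0.
Proof. by []. Qed.

Lemma SG_succ b n : 1 < b -> 2 <= n ->
  SG b n = mex [:: SG b n.-1; SG b (ceil_div n b)].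
Proof.
move=> b_gt1 n_gt1; have lt_c := ceil_div_lt b_gt1 n_gt1.
rewrite {1}/SG; case: n n_gt1 lt_c => // n n_gt1 lt_c.
rewrite [LHS]/= leqNgt n_gt1 /=.
by congr (mex [:: _; _]); apply: SG_fuelE.
Qed.

Record dfao (k : nat) (A : Type) := Dfao {
  dfao_state : finType;
  dfao_start : dfao_state;
  dfao_step : dfao_state -> 'I_k -> dfao_state;
  dfao_out : dfao_state -> A
}.

Definition dfao_run k A (M : dfao k A) (w : seq 'I_k) : A :=
  dfao_out (foldl (@dfao_step _ _ M) (dfao_start M) w).

Definition word_value k (w : seq 'I_k) : nat :=
  foldl (fun m (d : 'I_k) => m * k + d) 0 w.

(* w is the standard base-k expansion of n: most significant digit first and
   no leading zero. *)
Definition base_digits k (n : nat) (w : seq 'I_k) : bool :=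
  (word_value w == n) && (if w is d :: _ then val d != 0 else true).

Lemma base_digits_exists k n : 1 < k -> exists w : seq 'I_k, base_digits n w.
Proof.
move=> k_gt1; have k_gt0 := ltnW k_gt1.
elim/ltn_ind: n => -[|n] IH; first by exists [::].
have [|w /andP[/eqP wE w0]] := IH (n.+1 %/ k); first by rewrite ltn_Pdiv.
exists (rcons w (Ordinal (ltn_pmod n.+1 k_gt0))).
rewrite /base_digits /word_value -cats1 foldl_cat /= -/(word_value w) wE.
rewrite -divn_eq eqxx /=; case: w wE w0 => //= /esym/eqP.
move=> div0; have : n.+1 %/ k < 1 by rewrite (eqP div0).
by rewrite ltn_divLR // mul1n => /modn_small->.
Qed.

Lemma base_digits_uniq k n (w w' : seq 'I_k) :
  base_digits n w -> base_digits n w' -> w = w'.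
Proof.
pose nz (u : seq 'I_k) := if u is d :: _ then val d != 0 else true.
have valS (u : seq 'I_k) d : word_value (rcons u d) = word_value u * k + d.
  by rewrite /word_value -cats1 foldl_cat.
have nzS u d : nz (rcons u d) -> nz u by case: u.
have k_gt0 (d : 'I_k) : 0 < k by apply: leq_ltn_trans (ltn_ord d).
have val_gt0 u d : nz (rcons u d) -> 0 < word_value (rcons u d).
  elim/last_ind: u d => [|u e IH] d h; rewrite valS; first by rewrite lt0n.
  by rewrite addn_gt0 muln_gt0 (IH e (nzS _ _ h)) (k_gt0 d).
move=> /andP[/eqP <-] nz_w /andP[/eqP] + nz_w'.
elim/last_ind: w w' nz_w nz_w' => [|u d IH]; case/lastP => [//|u' d'] nz_w nz_w'.
- by move=> vE; have := val_gt0 _ _ nz_w'; rewrite vE.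
- by move=> vE; have := val_gt0 _ _ nz_w; rewrite -vE.
rewrite !valS => vE.
have -> : d' = d.
  by apply: val_inj; have := congr1 (modn^~ k) vE; rewrite /= !modnMDl !modn_small.
have uE : word_value u' = word_value u.
  have := congr1 (divn^~ k) vE.
  by rewrite /= !divnMDl ?(k_gt0 d) // !divn_small // !addn0.
by congr rcons; apply: IH uE; [apply: nzS nz_w | apply: nzS nz_w'].
Qed.

(* k-automaticity of the sequence a 1, a 2, ...; the value a 0 is ignored. *)
Definition automatic k A (a : nat -> A) : Prop :=
  exists M : dfao k A, forall (n : nat) (w : seq 'I_k),
    1 <= n -> base_digits n w -> dfao_run M w = a n.

(* Main.v *)
Require Import Defs.
From mathcomp Require Import all_boot.
From mathcomp Require Import zify.

Set Implicit Arguments.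
Unset Strict Implicit.
Unset Printing Implicit Defensive.

(** On the block b m < n <= b (m + 1) the value ceil (n / b) = m + 1 is constant,
    so SG there is obtained by iterating s |-> mex {s, u} with u = SG (m + 1),
    starting from SG (b m).  As b is even, a full block fixes {1, 2} pointwise
    when u = 0 and sends both 1 and 2 to 3 - u when u is 1 or 2.  Since SG b = 1,
    SG (b n) is never 0, and for n > 1 it equals 3 - SG c for the last c <= n with
    SG c <> 0; that c is n or n - 1, because consecutive values of SG differ.
    Hence (SG n, SG (n + 1), SG (b n)) is computable from the same triple at
    n / b and from the last digit of n. *)

Lemma automatic_of_state k A (a : nat -> A) (Q : finType) (q : nat -> Q)
    (step : Q -> 'I_k -> Q) (out : Q -> A) :
  (forall m d, q (m * k + val d) = step (q m) d) ->
  (forall n, 0 < n -> out (q n) = a n) -> automatic k a.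
Proof.
move=> q_step q_out; exists (Dfao (q 0) step out) => n w n_gt0 /andP[/eqP wE _].
rewrite -q_out // -wE /dfao_run /word_value /=; congr out.
elim: w 0 {wE} => //= d w IH m.
by rewrite -q_step IH.
Qed.

Lemma mex_pair s u :
  mex [:: s; u] = if 0 \notin [:: s; u] then 0
                  else if 1 \notin [:: s; u] then 1 else 2.
Proof.
rewrite /mex; case: ex_minnP => i; rewrite !inE => i_out i_min.
have := i_min 0; have := i_min 1; have := i_min 2; rewrite !inE.
by case: ifP; [|case: ifP]; lia.
Qed.

(** For [u = 0] each step swaps 1 and 2; for [u] equal to 1 or 2 the first step of a pair gives 0
    and the second gives [3 - u]. *)
Lemma iter_mex_even s u c : 0 < s <= 2 -> u <= 2 ->
  iter c.+1.*2 (fun t => mex [:: t; u]) s = if u == 0 then s else 3 - u.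
Proof.
move=> s12 u_le2; elim: c => [|c IH]; [|rewrite doubleS 2!iterS {}IH];
  rewrite /= !mex_pair !inE; case: s s12 => [|[|[|s]]] //;
  by case: u u_le2 => [|[|[|u]]].
Qed.

Section EvenBase.

Variable b : nat.
Hypotheses (b_ge2 : 1 < b) (b_even : ~~ odd b).

Lemma SG_le2 n : SG b n <= 2.
Proof.
case: n => [|[|n]] //; rewrite SG_succ // mex_pair.
by do 2?case: ifP.
Qed.

Lemma SG_block m d : 0 < m -> d <= b ->
  SG b (m * b + d) = iter d (fun t => mex [:: t; SG b m.+1]) (SG b (m * b)).
Proof.
move=> m_gt0; elim: d => [|d IH] d_le; first by rewrite addn0.
rewrite addnS SG_succ //=; last by nia.
rewrite IH ?(ltnW d_le) //; congr (mex [:: _; SG b _]).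
apply/eqP; rewrite eqn_leq leq_ceil_div ?(ltnW b_ge2) //.
by rewrite [m < _]ltnNge leq_ceil_div ?(ltnW b_ge2) //; apply/andP; split; nia.
Qed.

(** The total 1 is terminal, so this block is iterated from index 1 instead of 0. *)
Lemma SG_first_block d : d < b -> SG b d.+1 = iter d (fun t => mex [:: t; 0]) 0.
Proof.
elim: d => // d IH d_lt; rewrite SG_succ //= IH ?(ltnW d_lt) //.
congr (mex [:: _; _]); suff -> : ceil_div d.+2 b = 1 by [].
apply/eqP; rewrite eqn_leq leq_ceil_div ?(ltnW b_ge2) // mul1n d_lt.
by rewrite ceil_div_gt0 // ltnW.
Qed.

Lemma even_base_double : {c | b = c.+1.*2}.
Proof. by exists b.-2./2; lia. Qed.

Lemma SG_base : SG b b = 1.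
Proof.
have [c bE] := even_base_double.
have {2}-> : b = c.*2.+1.+1 by lia.
rewrite SG_first_block; last by lia.
(* The first step leads from 0 to 1; the remaining [b - 2] steps, an even number, preserve 1. *)
rewrite iterSr mex_pair /=; case: c {bE} => // c.
exact: iter_mex_even.
Qed.

Lemma SG_mulS n : 0 < n -> 0 < SG b (n * b) ->
  SG b (n.+1 * b) = if SG b n.+1 == 0 then SG b (n * b) else 3 - SG b n.+1.
Proof.
move=> n_gt0 T_gt0; have [c bE] := even_base_double.
rewrite {1}mulSn addnC SG_block // {1}bE iter_mex_even ?SG_le2 //.
by rewrite T_gt0.
Qed.

Lemma SG_mul_gt0 n : 0 < n -> 0 < SG b (n * b).
Proof.
case: n => // n _; elim: n => [|n IH]; first by rewrite mul1n SG_base.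
by rewrite SG_mulS //; case: ifP; rewrite ?IH // subn_gt0 ltnS SG_le2.
Qed.

(** If [SG b n.+1] is 0, then [SG b n] is not: the previous block ends in [3 - SG b n], and the
    current one preserves it. *)
Lemma SG_mul n : 0 < n ->
  SG b (n.+1 * b) = 3 - (if SG b n.+1 == 0 then SG b n else SG b n.+1).
Proof.
case: n => // n _; rewrite SG_mulS ?SG_mul_gt0 //; case: ifP => // SGn2.
have SGn1 : SG b n.+1 != 0.
  by move: SGn2; rewrite SG_succ // mex_pair !inE /=; do 2?case: ifP => //; lia.
case: n SGn1 {SGn2} => // n SGn1.
by rewrite SG_mulS ?SG_mul_gt0 // (negPf SGn1).
Qed.

(** [None] is the state before any nonzero digit, where the block formula does not apply yet. *)
Definition sg_triple n : option ('I_3 * 'I_3 * 'I_3) :=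
  if n == 0 then None
  else Some (inord (SG b n), inord (SG b n.+1), inord (SG b (n * b))).

(** From the triple at [m], [x i] recovers [SG b (m * b + i)]. *)
Definition sg_step (q : option ('I_3 * 'I_3 * 'I_3)) (d : 'I_b) :=
  if q is Some (_, u, T) then
    let x i := iter i (fun t => mex [:: t; val u]) (val T) in
    Some (inord (x d), inord (x d.+1),
          inord (3 - (if x d == 0 then x d.-1 else x d)))
  else sg_triple d.

Lemma sg_triple_step m (d : 'I_b) : sg_triple (m * b + d) = sg_step (sg_triple m) d.
Proof.
case: m => [|m] //; have d_lt := ltn_ord d.
have [n nE] : {n | m.+1 * b + d = n.+2} by exists (m.+1 * b + d).-2; nia.
rewrite /sg_triple {1}nE /= !inordK ?ltnS ?SG_le2 //.
rewrite -[mex _]/(iter d.+1 (fun t => mex [:: t; SG b m.+2]) _).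
rewrite -!SG_block ?addnS ?(ltnW d_lt) //; last by lia.
congr (Some (_, _, inord _)); rewrite nE SG_mul //; case: eqP => // SG0.
(* [SG] is nonzero at multiples of [b], so [d.-1] stays in the block. *)
have d_gt0 : 0 < d.
  rewrite lt0n; apply/eqP => d0; have := @SG_mul_gt0 m.+1 isT.
  by rewrite -[_ * b]addn0 -d0 nE SG0.
by congr (3 - SG b _); lia.
Qed.

End EvenBase.

Theorem theorem1 (b : nat) (b_ge2 : 2 <= b) (b_even : ~~ odd b) :
  automatic b (SG b).
Proof.
apply: (automatic_of_state (q := sg_triple b) (step := @sg_step b)
         (out := fun q => if q is Some (v, _, _) then val v else 0)).
  exact: sg_triple_step.
by case=> // n _; rewrite /= inordK // ltnS SG_le2.
Qed.
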